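(* Let $[0,1]\cup\{q\}$, where $q\notin[0,1]$, be equipped with the metric $d_1$ given by $d_1(x,y)=|x-y|$ for all $x,y\in[0,1]$ and $d_1(x,q)=d_1(q,x)=D$ for all $x\in[0,1]$ (and $d_1(q,q)=0$), where $D\gg 1$ is a constant. Then the $1$-Wasserstein space $\mathcal{W}_1([0,1]\cup\{q\},d_1)$ is isometrically rigid. That is, for every isometry $\Phi$ of $\mathcal{W}_1([0,1]\cup\{q\},d_1)$ onto itself there is an isometry $\psi$ of $([0,1]\cup\{q\},d_1)$ onto itself such that $\Phi=\psi_{\#}$.
   Context: For a Polish metric space $(X,d)$ and $p\ge 1$, $\mathcal{W}_p(X,d)$ is the set of Borel probability measures $\mu$ on $X$ with $\int_X d^p(x_0,x)\,d\mu(x)<\infty$ for some (hence any) $x_0\in X$, equipped with the Wasserstein distance $$d_{\mathcal{W}_p}(\mu,\nu)=\inf_{\pi\in\Pi(\mu,\nu)}\left(\int_{X\times X}d^p(x,y)\,d\pi(x,y)\right)^{1/p},$$ where $\Pi(\mu,\nu)$ is the set of couplings of $\mu$ and $\nu$, i.e. Borel probability measures on $X\times X$ with first marginal $\mu$ and second marginal $\nu$. An isometry is a distance-preserving surjective map. For a measurable map $\psi:X\to X$, the push-forward is $\psi_{\#}(\mu)(A)=\mu(\psi^{-1}(A))$ for Borel $A\subset X$. The condition $D\gg 1$ means that the point $q$ is placed uniformly far away from the interval $[0,1]$; no explicit threshold for $D$ is specified. *)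

(* Defs.v *)
From HB Require Import structures.
From mathcomp Require Import all_boot all_order all_algebra.
From mathcomp Require Import all_classical all_reals all_analysis.
From mathcomp Require Import lra.

Set Implicit Arguments.
Unset Strict Implicit.
Unset Printing Implicit Defensive.

Import Order.TTheory GRing.Theory Num.Theory.
Import numFieldNormedType.Exports.

Local Open Scope classical_set_scope.
Local Open Scope ring_scope.

(* The base point is not mathematical content: the library only builds
   generated sigma-algebras on pointed types. *)
#[short(type="pmetricType")]
HB.structure Definition PMetric (K : numDomainType) :=
  {M of Pointed M & Metric K M}.

Notation borel T := (g_sigma_algebraType (@open T)).

Section Wasserstein.
Context {R : realType} (T : pmetricType R) (p : R).

(* A library measure is a function on all subsets that is constrained only on
   the measurable ones, so two of them represent the same Borel measure when
   they agree on Borel sets; Leibniz equality would be too strong. *)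
Definition same_measure (mu nu : set (borel T) -> \bar R) : Prop :=
  forall A : set (borel T), measurable A -> mu A = nu A.

Definition finite_moment (mu : probability (borel T) R) : Prop :=
  exists x0 : T, (\int[mu]_x (mdist x0 x `^ p)%:E < +oo)%E.

Definition wspace : Type := {mu : probability (borel T) R | finite_moment mu}.

(* The sigma-algebra on T * T is generated by the open sets of the product
   topology. *)
Definition couplings (mu nu : probability (borel T) R) :
    set (probability (borel (T * T)%type) R) :=
  [set pi | (forall A : set (borel T), measurable A ->
               pi (fst @^-1` A) = mu A) /\
            (forall A : set (borel T), measurable A ->
               pi (snd @^-1` A) = nu A)].

Definition wdist (mu nu : wspace) : \bar R :=
  ereal_inf [set poweR (\int[pi]_z (mdist z.1 z.2 `^ p)%:E)%E p^-1 |
             pi in couplings (sval mu) (sval nu)].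

Definition is_isometry (psi : T -> T) : Prop :=
  (forall x y, mdist (psi x) (psi y) = mdist x y) /\
  (forall y, exists x, psi x = y).

(* Preserving [wdist] makes [Phi] compatible with [same_measure], so that it
   does induce a map on Borel measures. *)
Definition is_wisometry (Phi : wspace -> wspace) : Prop :=
  (forall mu nu, wdist (Phi mu) (Phi nu) = wdist mu nu) /\
  (forall nu : wspace, exists mu : wspace,
     same_measure (sval (Phi mu)) (sval nu)).

Definition isometrically_rigid : Prop :=
  forall Phi : wspace -> wspace, is_wisometry Phi ->
  exists2 psi : T -> T, is_isometry psi &
    forall mu : wspace, same_measure (sval (Phi mu))
      (pushforward (sval mu) (psi : borel T -> borel T)).

End Wasserstein.

(* The set [0, 1] \cup {q}, with q encoded as [None]. The proof argument, which
   only serves to make [d1] a metric, is part of the name of the type. *)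
Definition segment_point (R : realType) (D : R) of 1 <= D : Type :=
  option {x : R | x \in `[0, 1]}.

Section SegmentPoint.
Context {R : realType} (D : R) (hD : 1 <= D).
Local Notation X := (segment_point hD).

Definition d1 (x y : X) : R :=
  match x, y with
  | Some s, Some t => `|val s - val t|
  | None, None => 0
  | _, _ => D
  end.

Lemma d1xx x : d1 x x = 0.
Proof. by case: x => [s|] //=; rewrite subrr normr0. Qed.

Lemma d1_positivity x y : d1 x y = 0 -> x = y.
Proof.
have D0 : D <> 0 by move=> D0; have := hD; rewrite D0 ler10.
case: x y => [s|] [t|] //= /eqP.
by rewrite normr_eq0 subr_eq0 => /eqP/val_inj ->.
Qed.

Lemma d1_sym x y : d1 x y = d1 y x.
Proof. by case: x y => [s|] [t|] //=; rewrite distrC. Qed.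

Lemma d1_triangle y x z : d1 x z <= d1 x y + d1 y z.
Proof.
have D1 := hD.
case: x y z => [[s /= +]|] [[t /= +]|] [[u /= +]|] /=; rewrite ?in_itv /=.
- by move=> _ _ _; exact: ler_distD.
- by move=> _ _; rewrite lerDr.
- by move=> /andP[s0 s1] /andP[u0 u1]; rewrite ler_norml; lra.
- by move=> _; rewrite addr0.
- by move=> _ _; rewrite lerDl.
- by move=> _; lra.
- by move=> _; rewrite add0r.
- by rewrite addr0.
Qed.

HB.instance Definition _ := Choice.on X.
HB.instance Definition _ := isPointed.Build X (None : X).
HB.instance Definition _ :=
  isMetric.Build R X d1xx d1_positivity d1_sym d1_triangle.

Lemma mdist_d1 (x y : X) : mdist x y = d1 x y.
Proof. by []. Qed.

End SegmentPoint.

(* Main.v *)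
From HB Require Import structures.
Require Import Defs.
From mathcomp Require Import all_boot all_order all_algebra.
From mathcomp Require Import all_classical all_reals all_analysis.
From mathcomp Require Import ring lra measurable_realfun.

Set Implicit Arguments.
Unset Strict Implicit.
Unset Printing Implicit Defensive.

Import Order.TTheory GRing.Theory Num.Theory.
Import numFieldNormedType.Exports.

Local Open Scope classical_set_scope.
Local Open Scope ring_scope.

(* Write q for the isolated point and M(mu) for the mass of mu on [0, 1], so
   that W(mu, delta_q) = D * M(mu). Two measures at distance D from each other
   are delta_q and a measure carried by [0, 1]; hence Phi fixes delta_q and
   preserves M. Since moving mass to q is expensive, the equality
   W(mu, rho) = D * (M(mu) - M(rho)) holds exactly when rho <= mu on the Borel
   subsets of [0, 1], so Phi preserves this order. A measure of mass 1 on [0, 1]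
   is a Dirac mass iff it dominates only one measure of each mass, which gives
   Phi(delta_x) = delta_(psi x); and mu({x}) is the largest c such that
   c * delta_x <= mu, so mu({x}) = Phi(mu)({psi x}). Hence Phi is the
   push-forward by psi on finitely supported measures, which are dense. *)

(** * Borel maps and nonexpansive functions *)

Section GeneratedMaps.
Context {T U : pointedType} (G : set (set T)) (H : set (set U)).

Lemma measurable_generated (f : T -> U) :
  (forall B, H B -> G (f @^-1` B)) ->
  measurable_fun setT (f : g_sigma_algebraType G -> g_sigma_algebraType H).
Proof.
move=> GHf; apply: (@measurability _ _ (g_sigma_algebraType G)
  (g_sigma_algebraType H) setT f H); first by [].
by move=> _ [B HB <-]; rewrite setTI; apply: sub_sigma_algebra; exact: GHf.
Qed.

Lemma measurable_generated_real (R : realType) (f : T -> R) :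
  (forall B, open B -> G (f @^-1` B)) ->
  measurable_fun setT (f : g_sigma_algebraType G -> R).
Proof.
move=> Gf; apply: (@measurability _ _ (g_sigma_algebraType G) _ setT f
  (@RGenOInfty.G R)); first exact: RGenOInfty.measurableE.
move=> _ [_ [x ->] <-]; rewrite setTI; apply: sub_sigma_algebra.
by apply: Gf; exact: interval_open.
Qed.

End GeneratedMaps.

Section ImageMeasure.
Context d1 d2 (T1 : measurableType d1) (T2 : measurableType d2) (R : realType).
Variables (m : {measure set T1 -> \bar R}) (f : T1 -> T2).
Hypothesis mf : measurable_fun setT f.

(** The measurability proof is an argument so that the measure structure can be attached to the
    term. *)
Definition image_measure of measurable_fun setT f := pushforward m f.

Let im0 : image_measure mf set0 = 0%E. Proof. exact: measure0. Qed.
Let im_ge0 A : (0 <= image_measure mf A)%E. Proof. exact: measure_ge0. Qed.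
Let im_sigma_additive : semi_sigma_additive (image_measure mf).
Proof. exact: measure_semi_sigma_additive. Qed.

HB.instance Definition _ := isMeasure.Build _ _ _ (image_measure mf)
  im0 im_ge0 im_sigma_additive.
End ImageMeasure.

Section ProbabilityOf.
Context d (T : measurableType d) (R : realType).
Variables (m : {measure set T -> \bar R}) (m1 : m setT = 1%E).
Definition probability_of of m setT = 1%E := (m : set T -> \bar R).
HB.instance Definition _ := Measure.on (probability_of m1).
HB.instance Definition _ :=
  Measure_isProbability.Build _ _ _ (probability_of m1) m1.
End ProbabilityOf.

Lemma probability_ltoo d (T : measurableType d) (R : realType)
  (P : probability T R) : (P setT < +oo)%E.
Proof. by rewrite probability_setT ltry. Qed.

Section Metric.
Context {R : realType} {T : pmetricType R}.

(** One-sided, but exchanging x and y makes it the 1-Lipschitz condition. *)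
Definition nonexpansive (f : T -> R) := forall x y, f x - f y <= mdist x y.

Lemma nonexpansive_continuous f : nonexpansive f -> continuous f.
Proof.
move=> nf x; apply/cvgrPdist_lt => e e0; near=> y.
have xy : mdist x y < e.
  near: y; apply/metricType_numDomainType.nbhs_mdistP.
  by exists e.
rewrite (le_lt_trans _ xy)// ler_norml nf andbT lerNl opprB.
by rewrite (metric_sym x) nf.
Unshelve. all: by end_near. Qed.

Lemma isometry_continuous (psi : T -> T) :
  (forall x y, mdist (psi x) (psi y) = mdist x y) -> continuous psi.
Proof.
move=> ipsi x; apply/metricType_numDomainType.cvgrPdist_lt => e e0.
near=> y; rewrite ipsi; near: y.
by apply/metricType_numDomainType.nbhs_mdistP; exists e.
Unshelve. all: by end_near. Qed.

Lemma nonexpansive_reflect a f : nonexpansive f ->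
  nonexpansive (fun x => a + -1 * f x).
Proof. by move=> nf x y; rewrite metric_sym; have := nf y x; lra. Qed.

Lemma nonexpansive_dist x : nonexpansive (mdist x).
Proof.
by move=> y z; rewrite lerBlDl (metric_sym y) metric_triangle.
Qed.

Lemma continuous_dist : continuous (fun z : T * T => mdist z.1 z.2).
Proof.
move=> [x y]; apply/cvgrPdist_lt => e e0.
have e2 : 0 < e / 2 by rewrite divr_gt0.
have xz : \forall z \near ((x, y) : T * T), mdist x z.1 < e / 2.
  have : (fst : T * T -> T) @ (x, y) --> x by exact: cvg_fst.
  by move=> /metricType_numDomainType.cvgrPdist_lt; exact.
have yz : \forall z \near ((x, y) : T * T), mdist y z.2 < e / 2.
  have : (snd : T * T -> T) @ (x, y) --> y by exact: cvg_snd.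
  by move=> /metricType_numDomainType.cvgrPdist_lt; exact.
near=> z.
have xz1 : mdist x z.1 < e / 2 by near: z.
have yz2 : mdist y z.2 < e / 2 by near: z.
have t1 := metric_triangle x z.1 y; have t2 := metric_triangle z.1 z.2 y.
have t3 := metric_triangle z.1 x z.2; have t4 := metric_triangle x y z.2.
have s1 := metric_sym x z.1; have s2 := metric_sym y z.2.
rewrite /= ltr_norml; apply/andP; split; lra.
Unshelve. all: by end_near. Qed.

End Metric.

(** * Kantorovich duality and explicit couplings *)

Section Kantorovich.
Context {R : realType} {T : pmetricType R} (D : R).
Hypothesis dD : forall x y : T, mdist x y <= D.

Local Notation measureT := {measure set (borel T) -> \bar R}.
Implicit Types (mu nu : wspace T 1) (f : T -> R).

Lemma nonexpansive_measurable f : nonexpansive f ->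
  measurable_fun setT (f : borel T -> R).
Proof.
move=> nf; apply: measurable_generated_real => B oB.
by apply: open_comp => // x _; exact: nonexpansive_continuous.
Qed.

Lemma nonexpansive_bounded f : nonexpansive f ->
  [bounded f x | x in [set: T]].
Proof.
move=> nf; exists (`|f point| + D); split; first exact: num_real.
move=> M ltM x _; apply: (le_trans _ (ltW ltM)).
rewrite -[f x](subrK (f point)) (le_trans (ler_normD _ _))// addrC lerD2l.
rewrite ler_norml; have := nf x point; have := nf point x.
have := dD x point; have := dD point x; lra.
Qed.

Lemma nonexpansive_integrable (m : measureT) f : nonexpansive f ->
  (m setT < +oo)%E -> m.-integrable setT (EFin \o (f : borel T -> R)).
Proof.
move=> nf moo; apply: measurable_bounded_integrable => //.
  exact: nonexpansive_measurable.
exact: nonexpansive_bounded.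
Qed.

Lemma bounded_finite_moment (P : probability (borel T) R) :
  finite_moment (T := T) 1 P.
Proof.
exists point; under eq_integral do rewrite powRr1 ?mdist_ge0//.
apply: integrable_lty => //; apply: (nonexpansive_integrable (m := P)).
  exact: nonexpansive_dist.
exact: probability_ltoo.
Qed.

Definition wspace_of (P : probability (borel T) R) : wspace T 1 :=
  exist _ P (bounded_finite_moment P).

Definition mean mu f : R := (\int[sval mu]_x (f : borel T -> R) x)%R.

Lemma meanE mu f : nonexpansive f ->
  (mean mu f)%:E = (\int[sval mu]_x (f x)%:E)%E.
Proof.
move=> nf; rewrite fineK//; apply: integrable_fin_num => //.
by apply: nonexpansive_integrable => //; exact: probability_ltoo.
Qed.

Lemma same_measure_sym (m1 m2 : set (borel T) -> \bar R) :
  same_measure m1 m2 -> same_measure m2 m1.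
Proof. by move=> m12 A /m12. Qed.

(** Couplings see their marginals only through Borel sets. *)
Lemma same_wdist mu mu' nu nu' : same_measure (sval mu) (sval mu') ->
  same_measure (sval nu) (sval nu') -> wdist mu nu = wdist mu' nu'.
Proof.
move=> m12 n12; congr ereal_inf; congr image.
by apply/seteqP; split=> pi [pi1 pi2]; split=> A mA;
  rewrite ?pi1 ?pi2 ?m12 ?n12.
Qed.

Lemma coupling_costE (pi : probability (borel (T * T)%type) R) :
  poweR (\int[pi]_z (mdist z.1 z.2 `^ 1)%:E)%E 1^-1 =
  (\int[pi]_z (mdist z.1 z.2)%:E)%E.
Proof.
under eq_integral do rewrite powRr1 ?mdist_ge0//.
by rewrite invr1 poweRe1// integral_ge0// => z _; rewrite lee_fin mdist_ge0.
Qed.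

Lemma measurable_dist :
  measurable_fun setT (fun z : borel (T * T)%type => mdist z.1 z.2).
Proof.
apply: measurable_generated_real => B oB; apply: open_comp => // z _.
exact: continuous_dist.
Qed.

Lemma measurable_borel_fst :
  measurable_fun setT (fst : borel (T * T)%type -> borel T).
Proof. apply: measurable_generated => B oB.
by apply: open_comp => // z _; exact: cvg_fst. Qed.

Lemma measurable_borel_snd :
  measurable_fun setT (snd : borel (T * T)%type -> borel T).
Proof. apply: measurable_generated => B oB.
by apply: open_comp => // z _; exact: cvg_snd. Qed.

Lemma mean_marginal mu (pi : probability (borel (T * T)%type) R)
    (p : T * T -> T) f :
  measurable_fun setT (p : borel (T * T)%type -> borel T) ->
  (forall A : set (borel T), measurable A -> pi (p @^-1` A) = sval mu A) ->
  nonexpansive f ->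
  pi.-integrable setT (EFin \o (f \o p : borel (T * T)%type -> R)) /\
  mean mu f = \int[pi]_z (f (p z)).
Proof.
move=> mp pimu nf.
have ifp : pi.-integrable setT (EFin \o (f \o p : borel (T * T)%type -> R)).
  apply: measurable_bounded_integrable => //.
  - exact: probability_ltoo.
  - by apply: (measurableT_comp (nonexpansive_measurable nf)).
  - have [M [Mr fM]] := nonexpansive_bounded nf.
    by exists M; split=> // x Mx y _; exact: fM.
split=> //; congr fine.
rewrite -[RHS](integral_pushforward mp (D := setT) (f := EFin \o f))//.
  by apply: eq_measure_integral => A mA _; apply: esym; exact: pimu.
apply: measurableT_comp => //; exact: nonexpansive_measurable.
Qed.

(** The easy half of Kantorovich duality: integrate f x - f y <= d(x, y) against any coupling. *)
Lemma le_mean_wdist mu nu f : nonexpansive f ->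
  ((mean mu f - mean nu f)%:E <= wdist mu nu)%E.
Proof.
move=> nf; apply: le_ereal_inf_tmp => _ [pi [pi1 pi2] <-].
rewrite coupling_costE.
have [i1 ->] := mean_marginal measurable_borel_fst pi1 nf.
have [i2 ->] := mean_marginal measurable_borel_snd pi2 nf.
rewrite -RintegralB//=.
have ib : pi.-integrable setT
    (EFin \o (fun z : borel (T * T)%type => f z.1 - f z.2)).
  exact: (integrableB measurableT i1 i2).
rewrite fineK; last exact: integrable_fin_num.
apply: le_integral => //.
  apply: measurable_bounded_integrable => //.
  - exact: probability_ltoo.
  - exact: measurable_dist.
  - exists D; split; first exact: num_real.
    move=> M DM z _ /=; rewrite ger0_norm ?mdist_ge0//.
    by rewrite (le_trans (dD _ _))// ltW.
by move=> z _; rewrite lee_fin nf.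
Qed.

End Kantorovich.

(** * Nonexpansive functions determine a measure *)

Section DistanceToSet.
Context {R : realType} {T : pmetricType R} (C : set T).
Hypothesis C0 : C !=set0.

Definition dist_to (x : T) : R := inf [set mdist x c | c in C].

Let dist_to_has_inf x : has_inf [set mdist x c | c in C].
Proof.
split; last by exists 0 => _ [c _ <-]; exact: mdist_ge0.
by have [c Cc] := C0; exists (mdist x c), c.
Qed.

Lemma dist_to_le x c : C c -> dist_to x <= mdist x c.
Proof. by move=> Cc; apply: ge_inf; [case: (dist_to_has_inf x)|exists c]. Qed.

Lemma le_dist_to x r : (forall c, C c -> r <= mdist x c) -> r <= dist_to x.
Proof.
move=> rC; apply: lb_le_inf; first by case: (dist_to_has_inf x).
by move=> _ [c Cc <-]; exact: rC.
Qed.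

Lemma dist_to_ge0 x : 0 <= dist_to x.
Proof. by apply: le_dist_to => c _; exact: mdist_ge0. Qed.

Lemma dist_to_eq0 x : C x -> dist_to x = 0.
Proof.
move=> Cx; apply/eqP; rewrite eq_le dist_to_ge0 andbT.
by rewrite (le_trans (dist_to_le x Cx))// mdistxx.
Qed.

Lemma dist_to_gt0 x : open (~` C) -> ~ C x -> 0 < dist_to x.
Proof.
move=> oC Cx.
have /metricType_numDomainType.nbhs_mdistP[e /= e0 eC] : nbhs x (~` C).
  exact: open_nbhs_nbhs.
apply: (lt_le_trans e0); apply: le_dist_to => c Cc; rewrite leNgt.
by apply/negP => /eC /=; apply.
Qed.

Lemma nonexpansive_dist_to : nonexpansive dist_to.
Proof.
move=> x y; rewrite lerBlDr -lerBlDl; apply: le_dist_to => c Cc.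
by rewrite lerBlDl (le_trans (dist_to_le x Cc))// metric_triangle.
Qed.

End DistanceToSet.

Section Determination.
Context {R : realType} {T : pmetricType R} (D : R).
Hypothesis dD : forall x y : T, mdist x y <= D.
Implicit Types (mu nu : wspace T 1) (f g : T -> R).

(** The factor n + 1 is left out to keep the function nonexpansive; with it, the cutoffs of a closed
    set tend to the indicator of its complement. *)
Definition cutoff (C : set T) n x : R := Num.min n.+1%:R^-1 (dist_to C x).

Lemma nonexpansive_cutoff C n : C !=set0 -> nonexpansive (cutoff C n).
Proof.
move=> C0 x y; rewrite /cutoff; move: n.+1%:R^-1 => r.
have := mdist_ge0 x y; have := nonexpansive_dist_to C0 x y => ? ?.
by case: (lerP r (dist_to C x)) => ?; case: (lerP r (dist_to C y)) => ?; lra.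
Qed.

Lemma cutoff_ge0 C n x : C !=set0 -> 0 <= cutoff C n x.
Proof. by move=> C0; rewrite le_min invr_ge0 ler0n dist_to_ge0. Qed.

(** Dominated convergence: the scaled cutoffs lie between 0 and 1 and are, at each point, eventually
    equal to the indicator of U. *)
Lemma cvg_cutoff mu (U : set (borel T)) : open (U : set T) -> ~` U !=set0 ->
  (n.+1%:R * mean mu (cutoff (~` U) n))%:E @[n --> \oo] --> sval mu U.
Proof.
move=> oU C0; have mU : measurable U by exact: sub_sigma_algebra.
have nb n := nonexpansive_cutoff n C0.
rewrite -[U in sval mu U]setIT -(integral_indic _ measurableT mU).
have -> : (fun n => (n.+1%:R * mean mu (cutoff (~` U) n))%:E) =
    (fun n => \int[sval mu]_x (n.+1%:R * cutoff (~` U) n x)%:E)%E.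
  apply/funext => n; rewrite EFinM (meanE dD)// -integralZl//.
  by apply: (nonexpansive_integrable dD) => //; exact: probability_ltoo.
apply: (@dominated_cvg _ _ _ _ _ _ _ _ (EFin \o cst 1)) => //.
- move=> n; apply/measurable_EFinP; apply: measurable_funM => //.
  exact: nonexpansive_measurable.
- move=> x _; apply: cvg_near_cst.
  have [Ux|Ux] := pselect (U x).
    have dx : 0 < dist_to (~` U) x by apply: dist_to_gt0 => //; rewrite ?setCK.
    near=> n; rewrite indicE mem_set// /cutoff min_l ?mulfV//.
    by apply: ltW; near: n; exact: near_infty_natSinv_lt (PosNum dx).
  near=> n; rewrite indicE memNset// /cutoff dist_to_eq0// min_r ?mulr0//.
- exact: finite_measure_integrable_cst.
- move=> n x _; rewrite /= lee_fin ger0_norm ?mulr_ge0 ?cutoff_ge0//.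
  by rewrite mulrC -ler_pdivlMr// mul1r ge_min lexx.
Unshelve. all: by end_near. Qed.

(** Open sets form a pi-system generating the Borel sets, and their measures are limits of scaled
    means of cutoffs. *)
Lemma same_measure_mean mu nu :
  (forall f, nonexpansive f -> mean mu f = mean nu f) ->
  same_measure (sval mu) (sval nu).
Proof.
move=> mn A.
apply: (@measure_unique _ R (borel T) (@open T) (fun=> setT)) => //.
- by move=> B C oB oC; exact: openI.
- by move=> _; exact: openT.
- by rewrite bigcup_const.
(* Cutoffs need a nonempty complement, so the whole space is treated apart. *)
- move=> U oU; have [->|/setTPn C0] := eqVneq U setT.
    apply: etrans (probability_setT (sval mu)) _.
    exact: esym (probability_setT (sval nu)).
  have hmu := @cvg_cutoff mu _ oU C0; have hnu := @cvg_cutoff nu _ oU C0.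
  apply: etrans (esym (cvg_lim _ hmu)) _ => //.
  apply: etrans _ (cvg_lim _ hnu) => //.
  congr (lim _); congr (_ @ \oo); apply/funext => n.
  by rewrite mn//; exact: nonexpansive_cutoff.
- by move=> _; exact: probability_ltoo.
Qed.

Lemma mean_affine mu f (a b : R) : nonexpansive f ->
  mean mu (fun x => a + b * f x) = a + b * mean mu f.
Proof.
move=> nf.
have mf := nonexpansive_integrable dD nf (probability_ltoo (sval mu)).
rewrite /mean RintegralD//=.
- rewrite Rintegral_cst// RintegralZl//; congr (_ + _).
  rewrite -[RHS]mulr1; congr (_ * _).
  exact: (congr1 fine (probability_setT (sval mu))).
- exact: finite_measure_integrable_cst.
- exact: (integrableZl measurableT b mf).
Qed.

Lemma le_mean_affine mu f g (a b : R) : nonexpansive f -> nonexpansive g ->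
  (forall x, f x <= a + b * g x) -> mean mu f <= a + b * mean mu g.
Proof.
move=> nf ng fg; rewrite -mean_affine//.
have mf := nonexpansive_integrable dD nf (probability_ltoo (sval mu)).
have mg := nonexpansive_integrable dD ng (probability_ltoo (sval mu)).
have ma := finite_measure_integrable_cst (sval mu) a measurableT.
apply: le_Rintegral => //.
exact: (integrableD measurableT ma (integrableZl measurableT b mg)).
Qed.

(** Duality applied to f and to its reflection -f. *)
Lemma norm_mean_le_wdist mu nu f (e : R) : nonexpansive f ->
  (wdist mu nu <= e%:E)%E -> `|mean mu f - mean nu f| <= e.
Proof.
move=> nf We; have nNf := nonexpansive_reflect 0 nf.
have := le_trans (le_mean_wdist dD mu nu nf) We.
have := le_trans (le_mean_wdist dD mu nu nNf) We.
by rewrite !mean_affine// !lee_fin ler_norml => ? ?; apply/andP; split; lra.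
Qed.

Lemma same_measure_wdist0 mu nu : (wdist mu nu <= 0)%E ->
  same_measure (sval mu) (sval nu).
Proof.
move=> W0; apply: same_measure_mean => f nf.
by apply/eqP; rewrite -subr_eq0 -normr_le0; exact: norm_mean_le_wdist.
Qed.

Lemma mean_comp mu nu (psi : T -> T) f :
  measurable_fun setT (psi : borel T -> borel T) ->
  (forall A : set (borel T), measurable A ->
    sval nu A = sval mu (psi @^-1` A)) ->
  nonexpansive f -> nonexpansive (f \o psi) ->
  mean nu f = mean mu (f \o psi).
Proof.
move=> mpsi numu nf nfpsi; congr fine.
have ifp := nonexpansive_integrable dD nfpsi (probability_ltoo (sval mu)).
rewrite -[RHS](integral_pushforward mpsi (D := setT) (f := EFin \o f))//.
  by apply: eq_measure_integral => A mA _; exact: numu.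
by apply: measurableT_comp => //; exact: nonexpansive_measurable.
Qed.

End Determination.

(** * Transport plans made of finitely many maps *)

Section Transport.
Context {R : realType} {T : pmetricType R} (D : R).
Hypothesis dD : forall x y : T, mdist x y <= D.

Local Notation measureT := {measure set (borel T) -> \bar R}.
Implicit Types (mu nu : wspace T 1) (f : T -> R).

Lemma continuous_borel (g : T -> T) : continuous g ->
  measurable_fun setT (g : borel T -> borel T).
Proof.
move=> cg; apply: measurable_generated => B oB.
by apply: open_comp => // x _; exact: cg.
Qed.

Lemma graph_measurable (g : T -> T) : continuous g ->
  measurable_fun setT
    ((fun y => (y, g y)) : borel T -> borel (T * T)%type).
Proof.
move=> cg; apply: measurable_generated => B oB.
apply: open_comp => // x _.
by apply: cvg_pair => //=; exact: cg.
Qed.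

Lemma transport_exists n (m : nat -> measureT) (g : nat -> T -> T) mu :
  (forall i, continuous (g i)) ->
  (forall A, measurable A -> sval mu A = \sum_(i < n) m i A)%E ->
  exists nu, forall A, sval nu A = (\sum_(i < n) m i (g i @^-1` A))%E.
Proof.
move=> cg mum.
pose P := msum (fun i => image_measure (m i) (continuous_borel (cg i))) n.
have P1 : P setT = 1%E by rewrite -(probability_setT (sval mu)) mum.
by exists (wspace_of dD (probability_of P1)).
Qed.

(** The images of the pieces [m i] under the graphs of the maps [g i] add up to a coupling of mu and
    nu, whose cost is the right-hand side. *)
Lemma wdist_le_transport n (m : nat -> measureT) (g : nat -> T -> T) mu nu :
  (forall i, continuous (g i)) ->
  (forall A, measurable A -> sval mu A = \sum_(i < n) m i A)%E ->
  (forall A, measurable A -> sval nu A = \sum_(i < n) m i (g i @^-1` A))%E ->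
  (wdist mu nu <= \sum_(i < n) \int[m i]_y (mdist y (g i y))%:E)%E.
Proof.
move=> cg mum num.
pose P := msum (fun i => image_measure (m i) (graph_measurable (cg i))) n.
have P1 : P setT = 1%E by rewrite -(probability_setT (sval mu)) mum.
pose pi : probability (borel (T * T)%type) R := probability_of P1.
apply: ge_ereal_inf; exists (\int[pi]_z (mdist z.1 z.2)%:E)%E.
  exists pi; last exact: coupling_costE.
  by split=> A mA; rewrite ?mum ?num.
rewrite (ge0_integral_measure_sum
  (fun i => image_measure (m i) (graph_measurable (cg i))) measurableT)//.
- apply: lee_sum => i _.
  rewrite (ge0_integral_pushforward (graph_measurable (cg i)))//.
    by apply/measurable_EFinP; exact: measurable_dist.
  by move=> z _; rewrite lee_fin mdist_ge0.
- by move=> z _; rewrite lee_fin mdist_ge0.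
- by apply/measurable_EFinP; exact: measurable_dist.
Qed.

Lemma same_measure_wdist mu nu : same_measure (sval mu) (sval nu) ->
  (wdist mu nu <= 0)%E.
Proof.
move=> mn.
apply: le_trans
  (@wdist_le_transport 1 (fun=> sval mu) (fun=> id) mu nu _ _ _) _.
- by move=> _ x; exact: cvg_id.
- by move=> A mA; rewrite big_ord1.
- by move=> A mA; rewrite big_ord1 -mn.
- by rewrite big_ord1 integral0_eq// => y _; rewrite mdistxx.
Qed.

Definition wdirac (x : T) : wspace T 1 := wspace_of dD (\d_(x : borel T))%R.

Lemma wdiracE x (A : set (borel T)) :
  sval (wdirac x) A = ((x : borel T) \in A)%:R%:E.
Proof. exact: diracE. Qed.

Lemma measurable_mdist x : measurable_fun setT (mdist x : borel T -> R).
Proof. by apply: nonexpansive_measurable; exact: nonexpansive_dist. Qed.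

Lemma mean_dirac x f : nonexpansive f -> mean (wdirac x) f = f x.
Proof.
move=> nf; rewrite /mean /Rintegral integral_dirac// ?diracT ?mul1e//.
by apply/measurable_EFinP; exact: nonexpansive_measurable.
Qed.

(** Duality with [mdist x] bounds the distance from below; sending all of mu to x bounds it from
    above. *)
Lemma wdist_dirac mu x : wdist mu (wdirac x) = (mean mu (mdist x))%:E.
Proof.
apply/eqP; rewrite eq_le; apply/andP; split; last first.
  have nx := nonexpansive_dist x.
  have := le_mean_wdist dD mu (wdirac x) nx.
  by rewrite mean_dirac// mdistxx subr0.
rewrite (meanE dD); last exact: nonexpansive_dist.
apply: le_trans
  (@wdist_le_transport 1 (fun=> sval mu) (fun=> cst x) mu _ _ _ _) _.
- by move=> _ y; exact: cvg_cst.
- by move=> A mA; rewrite big_ord1.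
- move=> A mA; rewrite big_ord1 /= diracE.
  have [xA|xA] := pselect (A x).
    by rewrite mem_set// preimage_cst mem_set// probability_setT.
  by rewrite memNset// preimage_cst memNset// measure0.
- by rewrite big_ord1; under eq_integral do rewrite metric_sym.
Qed.

Lemma wdist_dirac_dirac x y : wdist (wdirac x) (wdirac y) = (mdist x y)%:E.
Proof.
by rewrite wdist_dirac mean_dirac ?(metric_sym y)//; exact: nonexpansive_dist.
Qed.

Lemma integral_le_support (m : measureT) (A : set (borel T)) f (r : R) :
  measurable A -> m (~` A) = 0%E ->
  measurable_fun setT (f : borel T -> R) -> (forall x, 0 <= f x) -> 0 <= r ->
  (forall x, A x -> f x <= r) -> (\int[m]_x (f x)%:E <= r%:E * m setT)%E.
Proof.
move=> mA mA0 mf f0 r0 fr; rewrite -integral_cst//.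
apply: ae_ge0_le_integral => //.
- by move=> x _; rewrite lee_fin.
- exact/measurable_EFinP.
- exists (~` A); split=> //; first exact: measurableC.
  move=> x /= nfr Ax; apply: nfr => _; rewrite lee_fin; exact: fr.
Qed.

(** Cut the space along the balls around the net, made disjoint, and collapse each piece to its
    centre: every point moves by less than e. *)
Lemma discretization mu (e : R) (n : nat) (x : nat -> T) : 0 < e ->
  (forall y, exists2 k, (k < n)%N & mdist (x k) y < e) ->
  exists nu (c : nat -> {nonneg R}),
    (forall A, sval nu A =
       \sum_(k < n) (c k)%:num%:E * \d_(x k : borel T) A)%E /\
    (wdist mu nu <= e%:E)%E.
Proof.
move=> e0 cov.
pose B k : set (borel T) := [set y | mdist (x k) y < e].
have mB k : measurable (B k).
  rewrite -[B k]setTI (_ : B k = mdist (x k) @^-1` `]-oo, e[).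
    exact: measurable_mdist.
  by apply/seteqP; split=> y /=; rewrite in_itv.
have UB : \big[setU/set0]_(k < n) seqDU B k = setT.
  rewrite -bigsetU_seqDU -bigcup_mkord; apply/seteqP; split=> // y _.
  by have [k kn yk] := cov y; exists k.
have mS := seqDU_measurable mB.
pose m k : measureT := mrestr (sval mu) (mS k).
have mum A : measurable A -> (sval mu A = \sum_(k < n) m k A)%E.
  move=> mA.
  have {1}-> : A = \big[setU/set0]_(k < n) (A `&` seqDU B k).
    by rewrite -(bigcup_mkord n (fun k => A `&` seqDU B k)) -setI_bigcupr
      bigcup_mkord UB setIT.
  apply: (@measure_bigsetU _ _ _ (sval mu) (fun k => A `&` seqDU B k)).
    by move=> k; exact: measurableI.
  exact: trivIset_setIl (trivIset_seqDU B).
have cx k : continuous (cst (x k) : T -> T) by move=> y; exact: cvg_cst.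
have [nu nuE] := transport_exists cx mum.
have mfin k : m k setT \is a fin_num.
  apply: (fin_num_measure (sval mu)).
  exact: (measurableI _ _ measurableT (mS k)).
have mge0 k : 0 <= fine (m k setT) by rewrite fine_ge0.
exists nu, (fun k => NngNum (mge0 k)); split=> [A|].
  rewrite nuE; apply: eq_bigr => k _ /=; rewrite (fineK (mfin k)) diracE.
  have [xA|xA] := pselect (A (x k)).
    by rewrite mem_set// preimage_cst mem_set// mule1.
  by rewrite memNset// preimage_cst memNset// measure0 mule0.
apply: le_trans (wdist_le_transport cx mum _) _ => //.
apply: (@le_trans _ _ (\sum_(k < n) e%:E * m k setT)%E).
  apply: lee_sum => k _; apply: (@integral_le_support _ (B k)) => //=.
  - by rewrite /m /mrestr -[RHS](measure0 (sval mu)); congr (sval mu _);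
       apply/seteqP; split=> // y [By [] /By].
  - by under eq_fun do rewrite metric_sym; exact: measurable_mdist.
  - by move=> y; rewrite mdist_ge0.
  - exact: ltW.
  - by move=> y yk; rewrite metric_sym ltW.
rewrite -ge0_sume_distrr// -mum//.
by rewrite (probability_setT (sval mu)) mule1.
Qed.

End Transport.

(** * Measures with finitely many atoms *)

Lemma set_seq_cons (T : eqType) (x : T) (s : seq T) :
  [set` x :: s] = [set x] `|` [set` s].
Proof.
apply/seteqP; split=> y /=; rewrite inE; first by case/predU1P; [left|right].
by case=> [->|->]; rewrite ?eqxx ?orbT.
Qed.

Section Atoms.
Context {R : realType} {T : pmetricType R}.

Lemma measurable_point (x : T) : measurable ([set x] : set (borel T)).
Proof.
rewrite -[[set x] : set (borel T)]setTI.
rewrite (_ : [set x] = (mdist x : borel T -> R) @^-1` [set 0]).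
  apply: measurable_generated_real => //.
  move=> B oB; apply: open_comp => // y _.
  exact/nonexpansive_continuous/nonexpansive_dist.
by apply/seteqP; split=> [y ->|y /mdist_positivity] //=; rewrite mdistxx.
Qed.

Lemma measurable_seq (s : seq T) : measurable ([set` s] : set (borel T)).
Proof.
elim: s => [|x s ms]; first by rewrite set_nil.
by rewrite set_seq_cons; apply: measurableU => //; exact: measurable_point.
Qed.

Variables (P Q : probability (borel T) R) (psi : T -> T).
Hypothesis psi_inj : injective psi.

(** Injectivity keeps the images of distinct atoms disjoint, so the atomwise bounds add up. *)
Lemma le_atoms (s : seq T) : uniq s ->
  (forall x, x \in s -> P [set x] <= Q [set psi x])%E ->
  (P [set` s] <= Q [set` map psi s])%E.
Proof.
elim: s => [_ _|x s ih /= /andP[xs us] PQ]; first by rewrite set_nil measure0.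
have mx := measurable_point; have ms := measurable_seq.
rewrite !set_seq_cons (measureU Q)//; last first.
  apply/seteqP; split=> // _ [-> /=] /mapP[y ys /psi_inj xy].
  by rewrite xy ys in xs.
apply: le_trans (measureU2 _ _ _) _ => //; apply: leeD.
  by apply: PQ; rewrite inE eqxx.
by apply: ih => // y ys; apply: PQ; rewrite inE ys orbT.
Qed.

Hypothesis mpsi : measurable_fun setT (psi : borel T -> borel T).

(** The points of s carry all of P, so P of the preimage of A is at most Q A for every Borel A. The
    same bound for the complement of A gives equality, both total masses being 1. *)
Lemma image_of_atoms (s : seq T) : P (~` [set` s]) = 0%E ->
  (forall x, P [set x] <= Q [set psi x])%E ->
  forall A : set (borel T), measurable A -> Q A = P (psi @^-1` A).
Proof.
move=> Ps PQ.
have mpre (A : set (borel T)) :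
    measurable A -> measurable (psi @^-1` A : set (borel T)).
  by move=> mA; rewrite -[_ @^-1` _]setTI; exact: mpsi.
have le (A : set (borel T)) : measurable A -> (P (psi @^-1` A) <= Q A)%E.
  (* [undup] removes repetitions, as additivity over the atoms requires. *)
  move=> mA; pose sA := [seq x <- undup s | psi x \in (A : set T)].
  have ms := measurable_seq.
  apply: (@le_trans _ _ (P ([set` sA] `|` ~` [set` s]))).
    apply: le_measure; rewrite ?inE; first exact: mpre.
      by apply: measurableU => //; exact: measurableC.
    move=> x Ax; have [xs|xs] := boolP (x \in s); last by right; exact/negP.
    by left; rewrite /= mem_filter mem_undup xs andbT inE.
  apply: le_trans (measureU2 _ _ _) _ => //; first exact: measurableC.
  rewrite [X in (_ + X)%E](_ : _ = 0%E) ?adde0//.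
  apply: le_trans (@le_atoms sA _ _) _ => //.
    by rewrite filter_uniq// undup_uniq.
  apply: le_measure; rewrite ?inE//.
  by move=> _ /mapP[x + ->]; rewrite mem_filter => /andP[/set_mem].
move=> A mA; apply/eqP; rewrite eq_le le// andbT.
have := le _ (measurableC mA); rewrite preimage_setC !probability_setC//.
  by rewrite leeD2lE// leeN2.
exact: mpre.
Qed.

End Atoms.

(** * Measures on the segment with an isolated point *)

Section SegmentPoint.
Context {R : realType} (D : R) (hD : 1 <= D).
Let X : pmetricType R := segment_point hD.
Let q : X := None.
Implicit Types (x y : X) (mu nu rho : wspace X 1) (f g : X -> R).

(** [insub] returns [None], which is q, when t lies outside [0, 1]. *)
Definition segment_pt (t : R) : X := insub t.

Lemma segment_ptE t (t01 : t \in `[0, 1]) : segment_pt t = Some (Sub t t01).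
Proof. by rewrite /segment_pt insubT. Qed.

Lemma segment_pt_neq t : t \in `[0, 1] -> segment_pt t <> q.
Proof. by move=> t01; rewrite (segment_ptE t01). Qed.

Lemma dist_segment_pt s t : s \in `[0, 1] -> t \in `[0, 1] ->
  mdist (segment_pt s) (segment_pt t) = `|s - t|.
Proof.
by move=> s01 t01; rewrite (segment_ptE s01) (segment_ptE t01) mdist_d1.
Qed.

Lemma segment_ptP x : x <> q -> exists2 t, t \in `[0, 1] & x = segment_pt t.
Proof.
by case: x => // -[t t01] _; exists t; rewrite ?(segment_ptE t01).
Qed.

Lemma dist_q x : x <> q -> mdist q x = D.
Proof. by case: x => // s _; rewrite mdist_d1. Qed.

Lemma dist_segment_le1 x y : x <> q -> y <> q -> mdist x y <= 1.
Proof.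
move=> /segment_ptP[s s01 ->] /segment_ptP[t t01 ->].
rewrite dist_segment_pt//; move: s01 t01; rewrite !in_itv/=.
by move=> /andP[? ?] /andP[? ?]; rewrite ler_norml; lra.
Qed.

Lemma dist_le x y : mdist x y <= D.
Proof.
have [->|/eqP xq] := eqVneq x q.
  have [->|/eqP yq] := eqVneq y q; last by rewrite dist_q.
  by rewrite mdistxx (le_trans ler01).
have [->|/eqP yq] := eqVneq y q; first by rewrite metric_sym dist_q.
by rewrite (le_trans (dist_segment_le1 xq yq)).
Qed.

Lemma segment_net (e : R) : 0 < e -> exists n (x : nat -> X),
  forall y, exists2 k, (k < n)%N & mdist (x k) y < e.
Proof.
(* N exceeds 1 / e, so the grid of the points k / N has mesh below e. *)
move=> e0; pose N := (Num.truncn e^-1).+1.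
have N0 : 0 < N%:R :> R by rewrite ltr0n.
have Ne : N%:R^-1 < e by rewrite invf_plt ?posrE// truncnS_gt.
(* The index k = N + 1 is out of range, so that segment_pt returns q. *)
exists N.+2, (fun k => segment_pt (k%:R / N%:R)) => y.
have [->|/eqP yq] := eqVneq y q.
  exists N.+1 => //; rewrite /segment_pt insubF ?mdistxx//.
  by apply/negP; rewrite in_itv/= ler_pdivrMr// mul1r ler_nat ltnn andbF.
have [t t01 ->] := segment_ptP yq.
move: (t01); rewrite in_itv/= => /andP[t0 t1].
(* k / N is the last grid point not beyond t. *)
pose k := Num.truncn (t * N%:R).
have tN0 : 0 <= t * N%:R by rewrite mulr_ge0// ltW.
have /andP[kt tk] := truncn_itv tN0; rewrite -/k in kt tk.
have kN : (k <= N)%N.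
  by rewrite -(ler_nat R) (le_trans kt)// ler_piMl// ltW.
have k01 : (k%:R / N%:R : R) \in `[0, 1].
  by rewrite in_itv/= divr_ge0//= ler_pdivrMr// mul1r ler_nat.
exists k; first by rewrite ltnS (leq_trans kN).
rewrite dist_segment_pt// (le_lt_trans _ Ne)// -(ler_pM2r N0) mulVf ?gt_eqF//.
rewrite -{2}(gtr0_norm N0) -normrM mulrBl divfK ?gt_eqF// ler_norml.
move: tk; rewrite -natr1; lra.
Qed.
End SegmentPoint.

(** * Mass on the segment and the order it induces *)

Section Mass.
Context {R : realType} (D : R) (hD : 1 <= D).
Let X : pmetricType R := segment_point hD.
Let q : X := None.
Let dD := @dist_le R D hD.
Local Notation delta := (wdirac dD).
Implicit Types (x y : X) (mu nu rho : wspace X 1) (f g : X -> R).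

Definition segment : set (borel X) := ~` [set q].

Lemma measurable_segment : measurable segment.
Proof. by apply: measurableC; exact: measurable_point. Qed.

Definition mass mu : R := fine (sval mu segment).

Lemma massE mu : sval mu segment = (mass mu)%:E.
Proof.
by rewrite fineK//; apply: fin_num_measure; exact: measurable_segment.
Qed.

Lemma mass_ge0 mu : 0 <= mass mu.
Proof. by rewrite fine_ge0. Qed.

Lemma mass_le1 mu : mass mu <= 1.
Proof.
rewrite -lee_fin -massE; apply: probability_le1; exact: measurable_segment.
Qed.

Lemma mass_q mu : sval mu [set q] = (1 - mass mu)%:E.
Proof.
have := probability_setC (sval mu) measurable_segment.
by rewrite /segment setCK massE -EFinB.
Qed.

Lemma same_mass mu nu : same_measure (sval mu) (sval nu) -> mass mu = mass nu.
Proof. by move=> mn; rewrite /mass mn//; exact: measurable_segment. Qed.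

(** [mdist q] is D times the indicator of the segment. The measure is arbitrary so that pieces of a
    probability measure are covered. *)
Lemma integral_dist_q (m : {measure set (borel X) -> \bar R}) :
  (\int[m]_y (mdist q y)%:E = D%:E * m segment)%E.
Proof.
rewrite -[segment in RHS]setIT -integral_indic//; last first.
  exact: measurable_segment.
rewrite -ge0_integralZl//=.
- apply: eq_integral => y _; rewrite indicE -EFinM; congr EFin.
  have [->|/eqP yq] := eqVneq y q.
    by rewrite mdistxx memNset ?mulr0//; exact.
  by rewrite dist_q// mem_set ?mulr1.
- by apply/measurable_EFinP; exact: measurable_indic measurable_segment.
- by rewrite lee_fin (le_trans ler01).
Qed.

Lemma mean_dist_q mu : mean mu (mdist q) = D * mass mu.
Proof.
apply: EFin_inj; rewrite (meanE dD); last exact: nonexpansive_dist.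
by rewrite integral_dist_q EFinM -massE.
Qed.

Lemma wdist_delta_q mu : wdist mu (delta q) = (D * mass mu)%:E.
Proof. by rewrite wdist_dirac mean_dist_q. Qed.

Lemma mass_delta x : x <> q -> mass (delta x) = 1.
Proof. by move=> xq; rewrite /mass wdiracE mem_set. Qed.

Lemma mass_delta_q : mass (delta q) = 0.
Proof. by rewrite /mass wdiracE memNset//; exact. Qed.

(* Since D is at least the diameter of the segment, this inequality (which
   is then an equality) says that rho <= mu on Borel subsets of the segment. *)
Definition below mu rho : Prop :=
  (wdist mu rho <= (D * (mass mu - mass rho))%:E)%E.

Lemma same_below mu mu' rho rho' : same_measure (sval mu) (sval mu') ->
  same_measure (sval rho) (sval rho') -> below mu rho -> below mu' rho'.
Proof.
by move=> m r; rewrite /below (same_wdist m r) (same_mass m) (same_mass r).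
Qed.

(** Duality with the test function [mdist q y - g y], which is nonexpansive because 0 <= g <= D; the
    terms in D cancel. *)
Lemma below_mean mu rho g : nonexpansive g -> (forall x, 0 <= g x) ->
  g q = 0 -> below mu rho -> mean rho g <= mean mu g.
Proof.
move=> ng g0 gq murho.
have nq := nonexpansive_dist q.
have nf : nonexpansive (fun y => mdist q y - g y).
  move=> x y; have [->|/eqP xq] := eqVneq x q.
    rewrite mdistxx gq; have := g0 y; have := ng y q; rewrite gq metric_sym.
    have := mdist_ge0 q y; lra.
  have [->|/eqP yq] := eqVneq y q.
    by rewrite mdistxx gq; have := g0 x; rewrite (metric_sym x); lra.
  by rewrite !dist_q//; have := ng y x; rewrite metric_sym; lra.
have mf nu : mean nu (fun y => mdist q y - g y) = D * mass nu - mean nu g.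
  rewrite -mean_dist_q; apply: RintegralB => //.
    by apply: (nonexpansive_integrable dD) => //; exact: probability_ltoo.
  by apply: (nonexpansive_integrable dD) => //; exact: probability_ltoo.
have := le_trans (le_mean_wdist dD mu rho nf) murho.
by rewrite !mf lee_fin; lra.
Qed.

(** Apply [below_mean] to bumps shrinking to x and pass to the limit on the complement of x. *)
Lemma below_atom mu rho x : x <> q -> below mu rho ->
  (sval rho [set x] <= sval mu [set x])%E.
Proof.
move=> xq murho; pose C : set X := [set x].
have C0 : C !=set0 by exists x.
have mx := @measurable_point R X x.
have oC : open (~` C).
  rewrite (_ : ~` C = mdist x @^-1` [set r | 0 < r]).
    apply: open_comp; last exact: open_gt.
    by move=> y _; exact/nonexpansive_continuous/nonexpansive_dist.
  apply/seteqP; split=> y /=.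
    by move=> yx; rewrite mdist_gt0; apply/eqP => /esym.
  by rewrite mdist_gt0 => /eqP xy /esym.
have CC : ~` (~` C) !=set0 by rewrite setCK.
have hmu := @cvg_cutoff _ _ _ dD mu _ oC CC.
have hrho := @cvg_cutoff _ _ _ dD rho _ oC CC.
rewrite setCK in hmu hrho.
suff : (sval mu (~` C) <= sval rho (~` C))%E.
  by rewrite !probability_setC// leeD2lE// leeN2.
apply: (lee_cvg_to hmu hrho); apply: nearW => n.
rewrite lee_fin ler_pM2l//.
(* The bump is r - [cutoff C n]; it vanishes at q because q is at distance D >= 1 >= r from x. *)
pose r : R := n.+1%:R^-1.
have nb := nonexpansive_cutoff n C0.
have nh := nonexpansive_reflect r nb.
have := @below_mean mu rho _ nh _ _ murho; rewrite !(mean_affine dD)//.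
move=> H.
suff : r + -1 * mean rho (cutoff C n) <= r + -1 * mean mu (cutoff C n).
  by lra.
apply: H => [y|].
  suff : cutoff C n y <= r by lra.
  by rewrite /cutoff ge_min lexx.
rewrite /cutoff min_l ?mulN1r ?subrr//.
apply: le_dist_to => // c ->; rewrite dist_q//.
by apply: le_trans hD; rewrite invf_le1// ler1n.
Qed.

(** The distance to x has mean 0 under the Dirac mass, hence also under rho on the segment, so rho
    is carried there by x. *)
Lemma below_delta x rho : x <> q -> below (delta x) rho ->
  sval rho [set x] = (mass rho)%:E.
Proof.
move=> xq xrho.
(* The value 0 at q is what [below_mean] requires; g stays nonexpansive since its jump at q is at
   most D. *)
pose g : X -> R := fun y => if y == q then 0 else mdist x y.
have g0 y : 0 <= g y by rewrite /g; case: ifP => // _; exact: mdist_ge0.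
have ng : nonexpansive g.
  move=> y z; rewrite /g; have [->|/eqP yq] := eqVneq y q.
    by rewrite sub0r; case: ifP => _; rewrite ?oppr0 ?mdist_ge0//;
      have := mdist_ge0 q z; have := mdist_ge0 x z; lra.
  have [->|/eqP zq] := eqVneq z q.
    by rewrite subr0 (metric_sym y) dist_q// dist_le.
  exact: nonexpansive_dist.
have gq : g q = 0 by rewrite /g eqxx.
have := below_mean ng g0 gq xrho; rewrite mean_dirac//.
rewrite {2}/g mdistxx if_same => rg.
have mg : measurable_fun setT (EFin \o (g : borel X -> R)).
  by apply: measurableT_comp => //; exact: nonexpansive_measurable.
have g0E : (\int[sval rho]_y `|(EFin \o g) y| = 0)%E.
  apply/eqP; rewrite eq_le integral_ge0 ?andbT//.
  under eq_integral do rewrite gee0_abs ?lee_fin//.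
  by rewrite -(meanE dD)// lee_fin.
have [N [mN rN gN]] := (ae_eq_integral_abs (sval rho) measurableT mg).1 g0E.
rewrite -massE; apply/eqP; rewrite eq_le; apply/andP; split.
  apply: le_measure; rewrite ?inE; first exact: measurable_point.
    exact: measurable_segment.
  by move=> _ ->.
apply: (@le_trans _ _ (sval rho ([set x] `|` N))).
  apply: le_measure; rewrite ?inE; first exact: measurable_segment.
    by apply: measurableU => //; exact: measurable_point.
  move=> y /= yq; have [xy|xy] := eqVneq x y; [by left|right].
  apply: gN => /=; rewrite /g ifF; last exact/eqP.
  by move=> /(_ I) [] /mdist_positivity /eqP; apply/negP.
apply: le_trans (measureU2 _ _ _) _ => //; first exact: measurable_point.
by rewrite [X in (_ + X)%E](_ : _ = 0%E) ?adde0.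
Qed.

End Mass.

(** * Construction and uniqueness of dominated measures *)

Section Below.
Context {R : realType} (D : R) (hD : 1 <= D).
Let X : pmetricType R := segment_point hD.
Let q : X := None.
Let dD := @dist_le R D hD.
Local Notation delta := (wdirac dD).
Local Notation segment := (@segment R D hD).
Local Notation measureX := {measure set (borel X) -> \bar R}.
Implicit Types (x y : X) (mu nu rho : wspace X 1).

Lemma not_segment_q : ~ segment q.
Proof. by move=> /(_ erefl). Qed.

Lemma same_off_q mu nu :
  (forall A : set (borel X), measurable A -> ~ A q ->
    sval mu A = sval nu A) -> same_measure (sval mu) (sval nu).
Proof.
move=> mn A mA; have [Aq|Aq] := pselect (A q); last exact: mn.
have mC := measurableC mA.
rewrite -[A]setCK (probability_setC (sval mu) mC).
rewrite (probability_setC (sval nu) mC); congr (_ - _)%E.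
by apply: mn => // nA; exact: nA.
Qed.

(** Keep m0 in place and send m1 to q: the cost is D times the mass of m1 on the segment, exactly
    the loss of mass that [below] allows. *)
Lemma compression mu (m0 m1 : measureX) :
  (forall A, measurable A -> sval mu A = m0 A + m1 A)%E ->
  exists2 rho, below mu rho &
    forall A : set (borel X), ~ A q -> sval rho A = m0 A.
Proof.
move=> mum; pose m i : measureX := if i is 0 then m0 else m1.
pose g i : X -> X := if i is 0 then id else cst q.
have cg i : continuous (g i).
  by case: i => [|i] y; [exact: cvg_id|exact: (@cst_continuous X X q y)].
have mum2 A : measurable A -> (sval mu A = \sum_(i < 2) m i A)%E.
  by move=> mA; rewrite big_ord_recl big_ord1 mum.
have [rho rhoE] := transport_exists dD cg mum2; exists rho; last first.
  move=> A Aq; rewrite rhoE big_ord_recl big_ord1 /=.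
  by rewrite preimage_cst memNset// measure0 adde0.
have rhoS : sval rho segment = m0 segment.
  rewrite rhoE big_ord_recl big_ord1 /= preimage_cst memNset ?measure0 ?adde0//.
  exact: not_segment_q.
apply: le_trans (wdist_le_transport cg mum2 _) _.
  by move=> A _; exact: rhoE.
have := mum _ (@measurable_segment R D hD).
rewrite big_ord_recl big_ord1 /= integral0_eq ?add0e; last first.
  by move=> y _; rewrite mdistxx.
under eq_integral do rewrite metric_sym.
rewrite integral_dist_q EFinM EFinB -!massE rhoS => ->.
have m0fin : m0 segment \is a fin_num.
  by rewrite -rhoS massE.
by rewrite addeAC subee// add0e.
Qed.

Lemma restriction_below mu (A : set (borel X)) : measurable A -> ~ A q ->
  exists2 rho, below mu rho &
    forall B : set (borel X), ~ B q -> sval rho B = sval mu (B `&` A).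
Proof.
move=> mA Aq.
apply: (@compression mu (mrestr (sval mu) mA)
  (mrestr (sval mu) (measurableC mA))) => B mB.
rewrite /= /mrestr -(measureU (sval mu)).
- by rewrite -setIUr setUCr setIT.
- exact: measurableI.
- by apply: measurableI => //; exact: measurableC.
- by rewrite setIACA setICr setI0.
Qed.

(** A second way, besides restriction, to produce a measure below mu of prescribed mass;
    [wisometry_delta] plays the two against each other. *)
Lemma scaling_below mu (s : R) : 0 <= s <= 1 ->
  exists2 rho, below mu rho &
    forall B : set (borel X), ~ B q -> sval rho B = (s%:E * sval mu B)%E.
Proof.
move=> /andP[s0 s1]; have s'0 : 0 <= 1 - s by rewrite subr_ge0.
apply: (@compression mu (mscale (NngNum s0) (sval mu))
  (mscale (NngNum s'0) (sval mu))) => B mB.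
by rewrite /= /mscale/= -ge0_muleDl ?lee_fin// -EFinD addrC subrK mul1e.
Qed.

Lemma below_deltaE x rho (A : set (borel X)) : x <> q -> below (delta x) rho ->
  measurable A -> ~ A q ->
  sval rho A = (if x \in (A : set X) then mass rho else 0)%:E.
Proof.
move=> xq xrho mA Aq; have rx := below_delta xq xrho.
have mx := @measurable_point R X x.
have mS := @measurable_segment R D hD.
case: ifPn => [/set_mem Ax|/negP Ax]; apply/eqP; rewrite eq_le.
  rewrite -{2}rx -massE; apply/andP; split; apply: le_measure; rewrite ?inE//.
    by move=> y /= Ay yq; apply: Aq; move: Ay; rewrite yq.
  by move=> y ->.
rewrite measure_ge0 andbT.
have le : (sval rho ([set x] `|` A) <= (mass rho)%:E)%E.
  rewrite -massE; apply: le_measure; rewrite ?inE//; first exact: measurableU.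
  by move=> y [->//|Ay yq]; apply: Aq; move: Ay; rewrite yq.
have xA : [set x] `&` A = set0.
  by apply/seteqP; split=> // y [-> /= Ax']; apply: Ax; exact: mem_set.
have e : sval rho ([set x] `|` A) = ((mass rho)%:E + sval rho A)%E.
  by apply: etrans (measureU (sval rho) mx mA xA) _; congr (_ + _)%E.
by move: le; rewrite e -[X in (_ <= X)%E -> _]adde0 leeD2lE.
Qed.

(** Off q both measures are carried by x, so the mass determines them. This uniqueness is the trait
    of Dirac masses that isometries transfer. *)
Lemma below_delta_same x rho rho' : x <> q -> below (delta x) rho ->
  below (delta x) rho' -> mass rho = mass rho' ->
  same_measure (sval rho) (sval rho').
Proof.
move=> xq b b' rr; apply: same_off_q => A mA Aq.
by rewrite (below_deltaE xq b mA Aq) (below_deltaE xq b' mA Aq) rr.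
Qed.

(** Cost of the product coupling: a copy of mu scaled by [c k] goes to [p k]. A pair of points costs
    D if exactly one of them is q, and at most 1 if neither is. *)
Lemma wdist_le_product mu nu n (c : nat -> {nonneg R}) (p : nat -> X) :
  (forall A, sval nu A = \sum_(k < n) (c k)%:num%:E * \d_(p k : borel X) A)%E ->
  (wdist mu nu <= (D * (mass nu * (1 - mass mu) + (1 - mass nu) * mass mu)
                   + mass nu * mass mu)%:E)%E.
Proof.
move=> nuE; set a := mass mu; set b := mass nu.
have c1 : \sum_(k < n) (c k)%:num = 1.
  apply: EFin_inj; rewrite -sumEFin -[RHS](probability_setT (sval nu)) nuE.
  by apply: eq_bigr => k _; rewrite diracT mule1.
have cb : \sum_(k < n) (c k)%:num * (p k != q)%:R = b.
  apply: EFin_inj; rewrite -sumEFin -massE nuE; apply: eq_bigr => k _.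
  rewrite EFinM diracE; congr (_ * _)%E.
  have [->|/eqP pq] := eqVneq (p k) q; last by rewrite mem_set.
  by rewrite memNset//; exact: not_segment_q.
have cp k : continuous (cst (p k) : X -> X).
  by move=> y; exact: (@cst_continuous X X (p k) y).
apply: le_trans (@wdist_le_transport R X n
  (fun k => mscale (c k) (sval mu)) (fun k => cst (p k)) mu nu cp _ _) _.
- move=> A mA; rewrite /= /mscale -ge0_sume_distrl//.
  rewrite [X in (X * _)%E](_ : _ = 1%E) ?mul1e//.
  by apply: etrans (congr1 EFin c1); rewrite sumEFin.
- move=> A mA; rewrite nuE; apply: eq_bigr => k _; rewrite /= /mscale diracE.
  have [pA|pA] := pselect (A (p k)).
    rewrite mem_set// preimage_cst mem_set//; congr (_ * _)%E.
    exact: esym (probability_setT (sval mu)).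
  by rewrite memNset// preimage_cst memNset// measure0.
(* Two cases in one formula: D * a for x = q, and a + D * (1 - a) for x on the segment. *)
have mean_p x :
    mean mu (mdist x) <= D * a + (x != q)%:R * (a + D * (1 - 2 * a)).
  have nd := nonexpansive_dist.
  have [->|/eqP xq] := eqVneq x q; first by rewrite mean_dist_q mul0r addr0.
  have D0 : D != 0 by rewrite gt_eqF// (lt_le_trans ltr01).
  (* This affine function of [mdist q] equals D at q and 1 on the segment, so it dominates the
     distance to x. *)
  rewrite mul1r [leRHS](_ : _ = D + (D^-1 - 1) * mean mu (mdist q)); last first.
    by rewrite mean_dist_q -/a; field.
  apply: (le_mean_affine dD) => // y; have [->|/eqP yq] := eqVneq y q.
    by rewrite mdistxx mulr0 addr0 dist_le.
  by rewrite dist_q// mulrBl mulVf// addrCA mul1r subrr addr0 dist_segment_le1.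
apply: (@le_trans _ _ (\sum_(k < n) ((c k)%:num *
    (D * a + (p k != q)%:R * (a + D * (1 - 2 * a))))%:E)%E).
  apply: lee_sum => k _; rewrite ge0_integral_mscale//.
  - rewrite EFinM; apply: lee_pmul => //.
      by apply: integral_ge0 => y _; rewrite lee_fin mdist_ge0.
    under eq_integral do rewrite metric_sym.
    by rewrite -(meanE dD) ?lee_fin ?mean_p//; exact: nonexpansive_dist.
  - apply/measurable_EFinP; under eq_fun do rewrite metric_sym.
    exact: measurable_mdist.
  - by move=> y _; rewrite lee_fin mdist_ge0.
rewrite sumEFin lee_fin; under eq_bigr do rewrite mulrDr mulrA.
rewrite big_split/= -!mulr_suml c1.
have -> : \sum_(k < n) (c k)%:num * ((p k != q)%:R * (a + D * (1 - 2 * a))) =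
    b * (a + D * (1 - 2 * a)).
  by rewrite -cb mulr_suml; apply: eq_bigr => k _; rewrite mulrA.
nra.
Qed.

End Below.

(** * Measures obeying a zero-one law *)

Section ZeroOne.
Context {R : realType} (D : R) (hD : 1 <= D).
Let X : pmetricType R := segment_point hD.
Let q : X := None.
Let dD := @dist_le R D hD.
Local Notation delta := (wdirac dD).
Local Notation segment := (@segment R D hD).
Implicit Types (x y : X) (mu : wspace X 1) (f : X -> R).

Lemma mean_le_support mu (A : set (borel X)) f (r : R) :
  measurable A -> sval mu A = 1%E -> nonexpansive f ->
  (forall x, 0 <= f x) -> (forall x, A x -> f x <= r) -> mean mu f <= r.
Proof.
move=> mA A1 nf f0 fr; have r0 : 0 <= r.
  have [[x Ax]|A0] := pselect (exists x, A x).
    exact: le_trans (f0 x) (fr x Ax).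
  have {}A0 : A = set0 by apply/seteqP; split=> // x Ax; apply: A0; exists x.
  by move: A1; rewrite A0 measure0 => /eqP; rewrite eqe eq_sym oner_eq0.
have A'0 : sval mu (~` A) = 0%E.
  by rewrite probability_setC// A1 -EFinB subrr.
have := integral_le_support mA A'0 (nonexpansive_measurable nf) f0 r0 fr.
rewrite -(meanE dD)// [X in (_ <= _ * X)%E -> _](_ : _ = 1%E).
  by rewrite mule1 lee_fin.
exact: probability_setT (sval mu).
Qed.

(* A 0-1 law makes every function constant almost everywhere, so mu is
   concentrated at the point whose coordinate is the mean of coordinates. *)
Lemma dirac_of_zero_one mu : mass mu = 1 ->
  (forall A : set (borel X), measurable A -> ~ A q ->
    sval mu A = 0%E \/ sval mu A = 1%E) ->
  exists y, same_measure (sval mu) (sval (delta y)).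
Proof.
move=> mass1 zero_one.
have mS := @measurable_segment R D hD.
have S1 : sval mu segment = 1%E by rewrite massE mass1.
have z01 : (0 : R) \in `[0, 1] by rewrite in_itv/= lexx ler01.
(* The distance to the endpoint 0 is the coordinate on the segment. *)
pose z : X := segment_pt hD 0.
have nz : nonexpansive (mdist z) := nonexpansive_dist z.
have mz := nonexpansive_measurable nz.
have zq : z <> q by exact: segment_pt_neq.
pose c := mean mu (mdist z).
have c01 : c \in `[0, 1].
  rewrite in_itv/=; apply/andP; split.
    by apply: Rintegral_ge0 => x _; exact: mdist_ge0.
  apply: (mean_le_support mS S1 nz) => [x|x xq]; first exact: mdist_ge0.
  exact: dist_segment_le1.
exists (segment_pt hD c); apply: (same_measure_wdist0 dD).
rewrite wdist_dirac lee_fin; apply/ler_addgt0Pr => e e0.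
rewrite add0r.
have mI (J : interval R) :
    measurable ([set x | mdist z x \in J] `&` segment : set (borel X)).
  apply: measurableI => //; rewrite -[X in measurable X]setTI.
  exact: mz measurableT _ (measurable_itv J).
have Iq (J : interval R) : ~ ([set x | mdist z x \in J] `&` segment) q.
  by case=> _ /(_ erefl).
(* If this set had measure 1, the mean c would be at most c - e. *)
have lo : sval mu ([set x | mdist z x \in `]-oo, c - e]] `&` segment) = 0%E.
  have [//|H] := zero_one _ (mI `]-oo, c - e]) (@Iq _).
  have : c <= c - e.
    apply: (mean_le_support (mI _) H nz) => [x|x [+ _]]; first exact: mdist_ge0.
    by rewrite /= in_itv.
  by rewrite lerBrDl gerDr leNgt e0.
have hi : sval mu ([set x | mdist z x \in `[c + e, +oo[] `&` segment) = 0%E.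
  have [//|H] := zero_one _ (mI `[c + e, +oo[) (@Iq _).
  (* Reflecting at D turns the lower bound on the coordinate into an upper bound while keeping the
     function nonnegative. *)
  have nf := nonexpansive_reflect D nz.
  have : mean mu (fun x => D + -1 * mdist z x) <= D - (c + e).
    apply: (mean_le_support (mI _) H nf) => [x|x [+ _]].
      by rewrite mulN1r subr_ge0 dD.
    by rewrite /= in_itv/= andbT mulN1r lerD2l lerN2.
  by rewrite (mean_affine dD)// mulN1r lerD2l lerN2 gerDl leNgt e0.
pose A : set (borel X) := [set x | mdist z x \in `]c - e, c + e[] `&` segment.
have mA : measurable A by exact: mI.
apply: (@mean_le_support _ A) => //.
- apply/eqP; rewrite eq_le probability_le1//= -S1.
  pose lo' := [set x | mdist z x \in `]-oo, c - e]] `&` segment : set (borel X).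
  pose hi' := [set x | mdist z x \in `[c + e, +oo[] `&` segment : set (borel X).
  apply: (@le_trans _ _ (sval mu (A `|` (lo' `|` hi')))).
    apply: le_measure; rewrite ?inE//.
      by apply: measurableU => //; apply: measurableU; exact: mI.
    move=> x xq; have [xlo|xlo] := lerP (mdist z x) (c - e).
      by right; left; split; rewrite //= in_itv.
    have [xhi|xhi] := lerP (c + e) (mdist z x).
      by right; right; split; rewrite //= in_itv/= xhi.
    by left; split; rewrite //= in_itv/= xlo xhi.
  apply: le_trans (measureU2 _ _ _) _ => //.
    by apply: measurableU; exact: mI.
  rewrite -[leRHS]adde0; apply: leeD => //.
  apply: le_trans (measureU2 _ _ _) _ => //; try exact: mI.
  rewrite -[leRHS]adde0; apply: leeD.
    by rewrite [leLHS](_ : _ = 0%E).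
  by rewrite [leLHS](_ : _ = 0%E).
- exact: nonexpansive_dist.
- by move=> x; exact: mdist_ge0.
- move=> x [/= + /= xq]; have [t t01 ->] := segment_ptP xq.
  rewrite !dist_segment_pt// sub0r normrN.
  move: (t01); rewrite !in_itv/= => /andP[t0 _]; rewrite (ger0_norm t0).
  move=> /andP[lot hit]; rewrite ler_norml; clear -lot hit.
  by apply/andP; split; lra.
Qed.

End ZeroOne.

(** * Isometries *)

Section Rigidity.
Context {R : realType} (D : R) (hD : 1 <= D).
Hypothesis D1 : 1 < D.
Let X : pmetricType R := segment_point hD.
Let q : X := None.
Let dD := @dist_le R D hD.
Local Notation delta := (wdirac dD).
Local Notation "mu ~ nu" := (same_measure (sval mu) (sval nu))
  (at level 70).
Implicit Types (x y : X) (mu nu : wspace X 1) (f : X -> R).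
Implicit Types Phi : wspace X 1 -> wspace X 1.

Lemma wisometry_same Phi mu nu : is_wisometry Phi ->
  mu ~ nu -> Phi mu ~ Phi nu.
Proof.
move=> [iPhi _] mn; apply: (same_measure_wdist0 dD); rewrite iPhi.
exact: same_measure_wdist.
Qed.

Lemma wisometry_inj Phi mu nu : is_wisometry Phi ->
  Phi mu ~ Phi nu -> mu ~ nu.
Proof.
move=> [iPhi _] mn; apply: (same_measure_wdist0 dD); rewrite -iPhi.
exact: same_measure_wdist.
Qed.

Lemma same_wdistr mu nu nu' : nu ~ nu' -> wdist mu nu = wdist mu nu'.
Proof. by move=> nn; apply: same_wdist. Qed.

Lemma same_delta x y : delta x ~ delta y -> x = y.
Proof.
move=> xy; have := same_measure_wdist xy.
rewrite wdist_dirac_dirac lee_fin => d0; apply: mdist_positivity.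
by apply/eqP; rewrite eq_le d0 mdist_ge0.
Qed.

(* The triangle inequality for W_1, which needs the gluing of couplings, is
   avoided by passing through a finitely supported theta near Phi (delta q)
   and measuring its preimage from the two Dirac masses. *)
Lemma wisometry_mass_alternative Phi x : is_wisometry Phi -> x <> q ->
  mass (Phi (delta q)) = 0 \/ mass (Phi (delta x)) = 0.
Proof.
move=> [iPhi sPhi] xq; set kappa := Phi (delta q); set nu := Phi (delta x).
set b := mass kappa; set a := mass nu.
have a0 : 0 <= a by exact: mass_ge0.
have a1 : a <= 1 by exact: mass_le1.
have b0 : 0 <= b by exact: mass_ge0.
have b1 : b <= 1 by exact: mass_le1.
have nq := nonexpansive_dist q.
(* D is the distance from delta q to delta x, and the right-hand side is the product-coupling bound
   for kappa and nu. Since D > 1, it reaches D only if a * b = 0. *)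
suff le : D <= D * (b * (1 - a) + (1 - b) * a) + b * a.
  have : a * b = 0.
    apply/eqP; rewrite eq_le mulr_ge0// andbT.
    have ab : 0 <= (1 - a) * (1 - b) by rewrite mulr_ge0// subr_ge0.
    have D0 : 0 < D - 1 by rewrite subr_gt0.
    have := mulr_ge0 (ltW D0) ab; rewrite -(pmulr_rle0 _ D0).
    by clear -le ab; lra.
  by move/eqP; rewrite mulf_eq0 => /orP[/eqP ->|/eqP ->]; [right|left].
apply/ler_addgt0Pr => e e0.
have e3 : 0 < e / 3 by rewrite divr_gt0.
have [n [p cov]] := segment_net hD e3.
have [theta [c [thetaE ktheta]]] := discretization dD kappa e3 cov.
have [theta' ttheta] := sPhi theta.
have dq : wdist (delta q) theta' = wdist kappa theta.
  by rewrite -(same_wdistr _ ttheta) iPhi.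
have dx : wdist (delta x) theta' = wdist nu theta.
  by rewrite -(same_wdistr _ ttheta) iPhi.
have h1 := norm_mean_le_wdist dD nq ktheta.
rewrite -dq in ktheta; have h2 := norm_mean_le_wdist dD nq ktheta.
have ntheta := wdist_le_product nu thetaE.
rewrite -dx in ntheta; have h3 := norm_mean_le_wdist dD nq ntheta.
have t0 := mass_ge0 theta; have t1 := mass_le1 theta.
(* With t and t' the masses of [theta] and [theta'], this reads: D * |b - t| <= e / 3, D * t' <= e /
   3, and D - D * t' is at most the product bound for a and t. *)
move: h1 h2 h3; rewrite !mean_dist_q mass_delta_q (mass_delta xq) -/a -/b.
rewrite !ler_norml mulr0 mulr1 => /andP[h1 h1'] /andP[h2 _] /andP[_ h3].
move: (mass theta) (mass theta') h1 h1' h2 h3 t0 t1 => t t'.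
clear -a0 a1 b0 b1 e0 D1 => h1 h1' h2 h3 t0 t1.
(* Replacing t by b changes the product bound by the sum of the left-hand sides of h4 and h5; the
   last e / 3 pays for D * t'. *)
have h4 : (t - b) * a <= e / 3.
  apply: (@le_trans _ _ `|t - b|).
    by rewrite (le_trans (ler_norm _))// normrM ler_piMr// ger0_norm.
  apply: (@le_trans _ _ (D * `|t - b|)); first by rewrite ler_peMl// ltW.
  have D0 : 0 <= D by rewrite ltW// (lt_trans ltr01).
  rewrite -{1}(ger0_norm D0) -normrM ler_norml; apply/andP; split; lra.
have h5 : D * (t - b) * (1 - 2 * a) <= e / 3.
  have [t2|t2] := lerP 0 (D * (t - b)); nra.
lra.
Qed.

(** Otherwise the alternative would send the Dirac masses at both endpoints to measures of mass 0,
    that is to delta q, against injectivity. *)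
Lemma wisometry_delta_q Phi : is_wisometry Phi -> Phi (delta q) ~ delta q.
Proof.
move=> wPhi.
have far mu : mass mu = 0 -> mu ~ delta q.
  move=> mu0; apply: (same_measure_wdist0 dD).
  by rewrite wdist_delta_q mu0 mulr0.
have i0 : (0 : R) \in `[0, 1] by rewrite in_itv/= lexx ler01.
have i1 : (1 : R) \in `[0, 1] by rewrite in_itv/= lexx ler01.
have q0 := segment_pt_neq i0; have q1 := segment_pt_neq i1.
have [/far//|/far m0] := wisometry_mass_alternative wPhi (q0 D hD).
have [/far//|/far m1] := wisometry_mass_alternative wPhi (q1 D hD).
have m01 : Phi (delta (segment_pt hD 0)) ~ Phi (delta (segment_pt hD 1)).
  by move=> A mA; rewrite m0// m1.
have /same_delta e01 := wisometry_inj wPhi m01.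
have := dist_segment_pt hD i0 i1.
by rewrite e01 mdistxx sub0r normrN normr1 => /eqP; rewrite eq_sym oner_eq0.
Qed.

(** D times the mass is the distance to delta q, which is fixed. *)
Lemma wisometry_mass Phi mu : is_wisometry Phi -> mass (Phi mu) = mass mu.
Proof.
move=> wPhi; have D0 : D != 0 by rewrite gt_eqF// (lt_trans ltr01).
apply: (mulfI D0); apply: EFin_inj; rewrite -!wdist_delta_q.
by rewrite -(same_wdistr _ (wisometry_delta_q wPhi)) wPhi.1.
Qed.

Lemma wisometry_below Phi mu nu : is_wisometry Phi ->
  below (Phi mu) (Phi nu) <-> below mu nu.
Proof. by move=> wPhi; rewrite /below wPhi.1 !wisometry_mass. Qed.

(** Let nu be the image and s = nu(A). The restriction of nu to A and the multiple s * nu, completed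
    at q, both lie below nu with mass s. Their preimages lie below delta x with equal mass, so they
    coincide; evaluating the two measures at A gives s = s * s, a zero-one law for nu. *)
Lemma wisometry_delta Phi x : is_wisometry Phi ->
  exists y, Phi (delta x) ~ delta y.
Proof.
move=> wPhi; have [->|/eqP xq] := eqVneq x q.
  by exists q; exact: wisometry_delta_q.
apply: dirac_of_zero_one; first by rewrite wisometry_mass// mass_delta.
set nu := Phi (delta x) => A mA Aq.
have nuS : sval nu (@segment R D hD) = 1%E.
  by rewrite massE wisometry_mass// mass_delta.
have AS : @segment R D hD `&` A = A.
  by apply/setIidPr => y Ay yq; apply: Aq; move: Ay; rewrite yq.
pose s := fine (sval nu A).
have sE : sval nu A = s%:E by rewrite fineK//; exact: fin_num_measure.
have s01 : 0 <= s <= 1 by rewrite -!lee_fin -sE measure_ge0 probability_le1.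
have [rho1 b1 rho1E] := restriction_below nu mA Aq.
have [rho2 b2 rho2E] := scaling_below nu s01.
have nSq := @not_segment_q R D hD.
have m12 : mass rho1 = mass rho2.
  by rewrite /mass rho1E// rho2E// AS nuS mule1 sE.
have [r1 r1E] := wPhi.2 rho1; have [r2 r2E] := wPhi.2 rho2.
have br (rho r : wspace X 1) : Phi r ~ rho -> below nu rho -> below (delta x) r.
  move=> rr b; apply/(wisometry_below _ _ wPhi).
  by apply: same_below b => // B mB; rewrite rr.
have mr (rho r : wspace X 1) : Phi r ~ rho -> mass r = mass rho.
  by move=> rr; rewrite -(wisometry_mass _ wPhi); exact: same_mass.
have r12 : r1 ~ r2.
  apply: (below_delta_same xq); [exact: br b1|exact: br b2|].
  by rewrite (mr _ _ r1E) (mr _ _ r2E).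
have rho12 : sval rho1 A = sval rho2 A.
  by rewrite -r1E// -r2E//; exact: (wisometry_same wPhi).
move: rho12; rewrite rho1E// rho2E// setIid sE -EFinM => -[] /eqP.
rewrite -{1}[s]mulr1 -subr_eq0 -mulrBr mulf_eq0 subr_eq0.
by move=> /orP[/eqP ->|/eqP <-]; [left|right].
Qed.

End Rigidity.

(** * Isometries as push-forwards *)

Section Representation.
Context {R : realType} (D : R) (hD : 1 <= D).
Hypothesis D1 : 1 < D.
Let X : pmetricType R := segment_point hD.
Let q : X := None.
Let dD := @dist_le R D hD.
Local Notation delta := (wdirac dD).
Local Notation "mu ~ nu" := (same_measure (sval mu) (sval nu))
  (at level 70).
Implicit Types (x y : X) (mu nu : wspace X 1) (f : X -> R).
Variables (Phi : wspace X 1 -> wspace X 1) (psi : X -> X).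
Hypothesis wPhi : is_wisometry Phi.
Hypothesis Phi_delta : forall x, Phi (delta x) ~ delta (psi x).

Lemma psi_dist x y : mdist (psi x) (psi y) = mdist x y.
Proof.
apply: EFin_inj; rewrite -!(wdist_dirac_dirac dD) -(wPhi.1 (delta x)).
by apply: same_wdist; apply: same_measure_sym; exact: Phi_delta.
Qed.

Lemma psi_inj : injective psi.
Proof.
by move=> x y xy; apply: mdist_positivity; rewrite -psi_dist xy mdistxx.
Qed.

Lemma psi_q : psi q = q.
Proof.
apply: (same_delta (hD := hD)) => A mA; rewrite -Phi_delta//.
exact: wisometry_delta_q.
Qed.

Lemma psi_continuous : continuous psi.
Proof. by apply: isometry_continuous; exact: psi_dist. Qed.

(** Moving all of mu except its atom at x to q gives theta, which lies below both mu and delta x. So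
    Phi theta lies below delta (psi x), which places its mass at psi x, and below Phi mu, which
    inherits that atom. *)
Lemma le_wisometry_atom mu x :
  (sval mu [set x] <= sval (Phi mu) [set psi x])%E.
Proof.
have [->|/eqP xq] := eqVneq x q.
  by rewrite psi_q !mass_q wisometry_mass.
have yq : psi x <> q by rewrite -psi_q => /psi_inj.
have mx := @measurable_point R X x.
have xNq : ~ [set x] q by move=> /esym.
have [theta mtheta thetaE] := restriction_below mu mx xNq.
pose c := fine (sval mu [set x]).
have cE : sval mu [set x] = c%:E by rewrite fineK//; exact: fin_num_measure.
have c01 : 0 <= c <= 1 by rewrite -!lee_fin -cE measure_ge0 probability_le1.
(* theta2 is c * delta x completed at q; it agrees with theta, which shows that theta lies below
   delta x. *)
have [theta2 xtheta2 theta2E] := scaling_below (delta x) c01.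
have theta12 : theta2 ~ theta.
  apply: same_off_q => B mB Bq; rewrite thetaE// theta2E// wdiracE.
  have [Bx|Bx] := pselect (B x).
    rewrite mem_set// mule1 -cE; congr (sval mu _).
    by apply/esym/setIidPr => _ ->.
  rewrite memNset// mule0 -[LHS](measure0 (sval mu)); congr (sval mu _).
  by apply/seteqP; split=> // y [By yx]; apply: Bx; rewrite -yx.
have below_psi : below (delta (psi x)) (Phi theta).
  apply: (same_below (Phi_delta x) (fun A _ => erefl)).
  apply/(wisometry_below D1 _ _ wPhi).
  exact: same_below theta12 xtheta2.
have Phi_mtheta : below (Phi mu) (Phi theta).
  exact/(wisometry_below D1 _ _ wPhi).
apply: le_trans (below_atom yq Phi_mtheta).
rewrite (below_delta yq below_psi) wisometry_mass// -massE.
rewrite thetaE; last exact: not_segment_q.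
apply: le_measure; rewrite ?inE//.
  by apply: measurableI => //; exact: measurable_segment.
by move=> _ ->; split.
Qed.

(** For a finitely supported theta within e / 2 of mu, Phi theta is the push-forward. Hence the mean
    of f under Phi mu and the mean of f o psi under mu are both within e / 2 of the mean of f o psi
    under theta. *)
Lemma wisometry_pushforward mu :
  same_measure (sval (Phi mu))
    (pushforward (sval mu) (psi : borel X -> borel X)).
Proof.
have mpsi := continuous_borel psi_continuous.
(* nu is the push-forward of mu, built as a point of the Wasserstein space so that means can be
   compared. *)
have [nu nuE] := @transport_exists R X D dD 1 (fun=> sval mu) (fun=> psi) mu
  (fun=> psi_continuous) (fun A _ => esym (big_ord1 _ _)).
have {}nuE A : sval nu A = sval mu (psi @^-1` A) by rewrite nuE big_ord1.
suff : Phi mu ~ nu by move=> munu A mA; rewrite munu// nuE.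
apply: (same_measure_mean dD) => f nf.
have nfpsi : nonexpansive (f \o psi) by move=> x y; rewrite -psi_dist nf.
rewrite (mean_comp dD mpsi (fun A _ => nuE A) nf nfpsi).
apply/eqP; rewrite -subr_eq0 -normr_le0; apply/ler_addgt0Pr => e e0.
have e2 : 0 < e / 2 by rewrite divr_gt0.
have [n [p cov]] := segment_net hD e2.
have [theta [c [thetaE mtheta]]] := discretization dD mu e2 cov.
have theta_supp : sval theta (~` [set` map p (iota 0 n)]) = 0%E.
  rewrite thetaE big1// => k _; rewrite diracE memNset ?mule0// => /=; apply.
  by apply/mapP; exists (k : nat); rewrite // mem_iota add0n ltn_ord.
have Phi_theta :=
  image_of_atoms psi_inj mpsi theta_supp (le_wisometry_atom theta).
have := norm_mean_le_wdist dD nfpsi mtheta.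
rewrite -wPhi.1 in mtheta; have := norm_mean_le_wdist dD nf mtheta.
rewrite (mean_comp dD mpsi Phi_theta nf nfpsi).
by rewrite !ler_norml => /andP[? ?] /andP[? ?]; apply/andP; split; lra.
Qed.

End Representation.

(** * The inverse isometry and rigidity *)

(** Choice picks preimages; injectivity up to [same_measure] makes the resulting map surjective in
    the required sense. It serves to prove psi onto. *)
Lemma wisometry_inverse (R : realType) (D : R) (hD : 1 <= D)
    (X := segment_point hD : pmetricType R)
    (Phi : wspace X 1 -> wspace X 1) : is_wisometry Phi ->
  exists2 Psi, is_wisometry Psi &
    forall nu, same_measure (sval (Phi (Psi nu))) (sval nu).
Proof.
move=> wPhi; have [Psi PsiE] := choice wPhi.2.
exists Psi => //; split=> [mu nu|mu].
  by rewrite -wPhi.1; exact: same_wdist.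
exists (Phi mu); apply: (wisometry_inj wPhi); exact: PsiE.
Qed.

Theorem theorem1p1 (R : realType) :
  exists D0 : R, forall (D : R) (hD : 1 <= D), D0 <= D ->
    isometrically_rigid (segment_point hD : pmetricType R) 1.
Proof.
(* The threshold 2 secures the strict inequality D > 1 on which [wisometry_mass_alternative]
   rests. *)
exists 2 => D hD D2 Phi wPhi.
have D1 : 1 < D by rewrite (lt_le_trans _ D2)// ltr1n.
have [psi psiE] := choice (fun x => wisometry_delta D1 x wPhi).
exists psi; last by move=> mu; exact: wisometry_pushforward.
split=> [x y|y]; first exact: psi_dist psiE _ _.
(* The inverse isometry also maps Dirac masses to Dirac masses, so delta y comes from some delta x,
   and then psi x = y. *)
have [Psi wPsi PhiPsi] := wisometry_inverse wPhi.
have [x xy] := wisometry_delta D1 y wPsi; exists x.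
apply: (same_delta (hD := hD)) => A mA.
by rewrite -psiE// -(wisometry_same wPhi xy)// PhiPsi.
Qed.
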